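(* Let $k$ be an algebraic closure of $\mathbb{F}_q$. Let $\mathcal{J}$ be a homogeneous ideal of $k[x_0,\dots,x_m]$ and let $X=V(\mathcal{J})$ be the corresponding projective algebraic variety in $\mathbb{P}^m(k)$. Then $$|X(\mathbb{F}_q)| = |\Delta_e(\mathcal{J}_q)|\quad\text{for all } e\gg 0.$$
   Context: $q$ is a prime power, $\mathbb{F}_q$ is the finite field with $q$ elements, and $m$ is a positive integer. $V(\mathcal{J})$ is the set of all $P\in\mathbb{P}^m(k)$ such that $F(P)=0$ for all homogeneous $F\in\mathcal{J}$, and $X(\mathbb{F}_q)=X\cap\mathbb{P}^m(\mathbb{F}_q)$ is its set of $\mathbb{F}_q$-rational points. $\Gamma_q(k)$ is the ideal of $k[x_0,\dots,x_m]$ generated by the polynomials $x_i^qx_j-x_ix_j^q$ for $0\le i<j\le m$, and $\mathcal{J}_q:=\mathcal{J}+\Gamma_q(k)$. A monomial order $\preccurlyeq$ on the set of all monomials in $x_0,\dots,x_m$ is fixed, with $x_0\succ x_1\succ\cdots\succ x_m$; $\mathrm{lm}(F)$ denotes the leading monomial of a nonzero polynomial $F$ with respect to it. $\mathbb{M}_e$ is the set of monomials in $x_0,\dots,x_m$ of degree $e$. For a homogeneous ideal $\mathcal{I}$ of $k[x_0,\dots,x_m]$ and $e\in\mathbb{N}=\{0,1,2,\dots\}$, the projective footprint of $\mathcal{I}$ in degree $e$ is $$\Delta_e(\mathcal{I}):=\{\mu\in\mathbb{M}_e : \mu\ne \mathrm{lm}(F)\text{ for all homogeneous }F\in\mathcal{I}\text{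 with }F\ne 0\}.$$ ''For all $e\gg 0$'' means: there is $e_0\in\mathbb{N}$ such that the assertion holds for all integers $e\ge e_0$. *)

(* Defs.v *)
From mathcomp Require Import all_boot all_order all_algebra.
From mathcomp Require Import boolp classical_sets cardinality.
From mathcomp Require Import mpoly.

Set Implicit Arguments.
Unset Strict Implicit.
Unset Printing Implicit Defensive.

Import GRing.Theory.

Local Open Scope ring_scope.
Local Open Scope classical_set_scope.

Section Ideals.
Variable (R : comNzRingType).

(* Unlike the [idealr] structures of [ring_quotient], the unit ideal is
   allowed. *)
Definition is_ideal (I : set R) : Prop :=
  [/\ I 0, forall f g, I f -> I g -> I (f + g) & forall h f, I f -> I (h * f)].

Definition ideal_gen (G : set R) : set R :=
  [set f | exists s : seq (R * R),
    (forall c, c \in s -> G c.2) /\ f = \sum_(c <- s) c.1 * c.2].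

Definition ideal_add (I J : set R) : set R :=
  [set f | exists g h, [/\ I g, J h & f = g + h]].

End Ideals.

Definition homogeneous_ideal (n : nat) (R : comNzRingType)
    (I : set {mpoly R[n]}) : Prop :=
  is_ideal I /\ forall (d : nat) f, I f -> I (pihomog mdeg d f).

Section MonomialOrder.
Variable n : nat.

(* Exponent vectors represent monomials: [0%MM] is the monomial 1, [U_(i)%MM]
   is the variable x_i, and [(a + b)%MM] is a product of monomials.  A total
   multiplicative order with least element 1 is a well-order, by Dickson's
   lemma. *)
Definition monomial_order (le : rel 'X_{1..n}) : Prop :=
  [/\ antisymmetric le, transitive le, total le,
      forall a b c, le a b -> le (a + c)%MM (b + c)%MM
    & forall a, le 0%MM a].

Definition vars_decreasing (le : rel 'X_{1..n}) : Prop :=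
  forall i j : 'I_n, (i < j)%N ->
    le U_(j)%MM U_(i)%MM /\ U_(j)%MM <> U_(i)%MM :> 'X_{1..n}.

(* The index value [0%MM] is the least monomial, hence neutral; it is also the
   (irrelevant) value at [F = 0]. *)
Definition lm (R : nzRingType) (le : rel 'X_{1..n}) (F : {mpoly R[n]}) :
    'X_{1..n} :=
  \big[(fun a b => if le a b then b else a)/0%MM]_(a <- msupp F) a.

Definition footprint (R : nzRingType) (le : rel 'X_{1..n})
    (I : set {mpoly R[n]}) (e : nat) : set 'X_{1..n} :=
  [set mu | mdeg mu = e /\
    forall F, F \is homog mdeg -> I F -> F != 0 -> mu <> lm le F].

End MonomialOrder.

(* A point with homogeneous coordinates v is the line spanned by v. *)
Definition proj_space (k : fieldType) (m : nat) :=
  {P : {vspace 'rV[k]_m.+1} | \dim P == 1%N}.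

Section ProjectiveSpace.
Variables (k : fieldType) (m : nat).

Definition is_coord (v : 'rV[k]_m.+1) (P : proj_space k m) : Prop :=
  val P = <[v]>%VS.

(* For homogeneous F, the choice of coordinates of P is immaterial. *)
Definition vanishes_at (F : {mpoly k[m.+1]}) (P : proj_space k m) : Prop :=
  forall v, is_coord v P -> F.@[v 0] = 0.

Definition zero_locus (J : set {mpoly k[m.+1]}) : set (proj_space k m) :=
  [set P | forall F, F \is homog mdeg -> J F -> vanishes_at F P].

Definition proj_rational (K : fieldType) (iota : {rmorphism K -> k}) :
    set (proj_space k m) :=
  [set P | exists v : 'rV[K]_m.+1, is_coord (map_mx iota v) P].

Definition rational_points (K : fieldType) (iota : {rmorphism K -> k})
    (X : set (proj_space k m)) : set (proj_space k m) :=
  X `&` proj_rational iota.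

Definition Gamma (q : nat) : set {mpoly k[m.+1]} :=
  ideal_gen [set f | exists i j : 'I_m.+1,
    (i < j)%N /\ f = 'X_i ^+ q * 'X_j - 'X_i * 'X_j ^+ q].

Definition ideal_q (q : nat) (J : set {mpoly k[m.+1]}) : set {mpoly k[m.+1]} :=
  ideal_add J (Gamma q).

End ProjectiveSpace.

(* Main.v *)
Require Import Defs.
From mathcomp Require Import all_boot all_order all_algebra finfield.
From mathcomp Require Import boolp classical_sets cardinality.
From mathcomp Require Import mpoly.
From mathcomp Require Import zify.

Set Implicit Arguments.
Unset Strict Implicit.
Unset Printing Implicit Defensive.

Import GRing.Theory.

Local Open Scope ring_scope.
Local Open Scope classical_set_scope.
Local Open Scope card_scope.

(* A monomial restricted to F_q^(m+1) depends only on its exponents reduced to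
   {0, ..., q-1}, and distinct reduced monomials are linearly independent
   functions.  Two monomials of the same degree with the same reduction are
   congruent modulo Gamma_q (shift q-1 units of exponent from one variable to
   another), so Gamma_q contains every form vanishing on F_q^(m+1), in every
   degree.  In large degree there are forms separating any rational point from
   the others; multiplying them by elements of J not vanishing at the rational
   points outside X shows that the forms of degree e in J_q are exactly those
   vanishing on X(F_q).  Finally, the values of the footprint monomials at
   X(F_q) form an invertible matrix. *)

(** * Ideals and exponent vectors *)

Lemma ideal_gen_is_ideal (R : comNzRingType) (G : set R) :
  is_ideal (ideal_gen G).
Proof.
split=> [|f g [s [sG ->]] [t [tG ->]]|h f [s [sG ->]]].
- by exists [::]; split=> //; rewrite big_nil.
- exists (s ++ t); split; last by rewrite big_cat.
  by move=> c; rewrite mem_cat => /orP[/sG|/tG].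
- exists [seq (h * c.1, c.2) | c <- s]; split.
    by move=> c /mapP[d /sG Gd ->].
  by rewrite big_map mulr_sumr; apply: eq_bigr => c _; rewrite mulrA.
Qed.

Lemma ideal_gen_sub (R : comNzRingType) (G : set R) : G `<=` ideal_gen G.
Proof.
move=> g Gg; exists [:: (1, g)]; split; last by rewrite big_seq1 mul1r.
by move=> c; rewrite inE => /eqP->.
Qed.

Lemma ideal_opp (R : comNzRingType) (I : set R) f :
  is_ideal I -> I f -> I (- f).
Proof. by case=> _ _ IM If; rewrite -mulN1r; apply: IM. Qed.

Lemma ideal_sum (R : comNzRingType) (I : set R) (T : Type) (r : seq T)
    (P : pred T) (F : T -> R) :
  is_ideal I -> (forall t, P t -> I (F t)) -> I (\sum_(t <- r | P t) F t).
Proof. by case=> I0 ID _ IF; elim/big_ind: _. Qed.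

Lemma mdeg_eq_lt n (a b : 'X_{1..n}) : mdeg a = mdeg b -> a != b ->
  exists i, (b i < a i)%N.
Proof.
move=> dab nab; apply/existsP; apply: contraNT nab.
rewrite negb_exists => /forallP leab.
have le i : (a i <= b i)%N by rewrite leqNgt leab.
move/eqP: dab; rewrite !mdegE.
have /leqif_sum leS i : true -> (a i <= b i ?= iff (a i == b i))%N.
  by move=> _; split.
by rewrite (eq_leqif leS) => /forallP eqab; apply/eqP/mnmP => i; apply/eqP/eqab.
Qed.

(** * Reduced exponents and the forms vanishing on all of F_q^(m+1) *)

Section Frobenius.
Variables (Fq : finFieldType) (k : fieldType) (iota : {rmorphism Fq -> k}).
Local Notation q := #|Fq|.

(* The least exponent inducing the same power function on F_q; 0 and q - 1 are
   told apart by the value at 0. *)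
Definition red_exp (a : nat) : nat := if a is b.+1 then (b %% q.-1).+1 else 0.

Lemma red_exp_lt a : (red_exp a < q)%N.
Proof.
have q1 := finNzRing_gt1 Fq; case: a => [|b] /=; first exact: ltnW.
by rewrite -[X in (_ < X)%N](ltn_predK q1) ltnS ltn_mod -ltnS (ltn_predK q1).
Qed.

Lemma expf_red (x : Fq) a : x ^+ red_exp a = x ^+ a.
Proof.
case: a => // b /=; rewrite [in RHS](divn_eq b q.-1).
elim: (b %/ _)%N => [|t IH]; first by rewrite mul0n.
rewrite IH mulSn -addnA -[in RHS]addSn (ltn_predK (finNzRing_gt1 Fq)).
by rewrite exprD expf_card -exprS.
Qed.

Lemma red_expD a : (0 < a)%N -> red_exp (a + q.-1) = red_exp a.
Proof. by case: a => // a _; rewrite /= modnDr. Qed.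

(** Only 0 reduces to 0, and positive exponents with equal reductions differ by a multiple of
    [q.-1]. This leaves room to shift [q.-1] units of exponent. *)
Lemma red_exp_gt a b : red_exp a = red_exp b -> (b < a)%N ->
  (0 < b)%N /\ (b + q.-1 <= a)%N.
Proof.
case: a b => [|a] [|b] //= [] ab; rewrite ltnS => lt_ba; split=> //.
rewrite addSn ltnS (divn_eq a q.-1) (divn_eq b q.-1) ab.
rewrite addnAC -mulSnr leq_add2r leq_mul2r; apply/orP; right.
rewrite ltnNge; apply: contraTN lt_ba => le_ab.
by rewrite -leqNgt (divn_eq a q.-1) (divn_eq b q.-1) ab leq_add2r leq_mul2r
  le_ab orbT.
Qed.

(** The Vandermonde matrix of the [q] distinct elements of F_q is invertible; [lam] is column [b] of
    its inverse. *)
Lemma power_functional (b : 'I_q) :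
  exists lam : Fq -> k, forall a,
    \sum_x lam x * iota x ^+ a = (red_exp a == b)%:R.
Proof.
pose V : 'M[k]_q := Vandermonde q (\row_j iota (enum_val j)).
have Vu : V \in unitmx.
  rewrite unitmxE det_Vandermonde unitfE; apply/prodf_neq0 => i _.
  apply/prodf_neq0 => j ij; rewrite !mxE subr_eq0; apply/eqP => /fmorph_inj.
  by move=> /enum_val_inj ji; rewrite ji ltnn in ij.
exists (fun x => invmx V (enum_rank x) b) => a.
have := mulmxV Vu => /matrixP/(_ (Ordinal (red_exp_lt a)) b).
rewrite !mxE -val_eqE /= => <-.
rewrite (reindex (@enum_val Fq predT)) /=; last first.
  by apply: onW_bij; apply: enum_val_bij.
apply: eq_bigr => j _; rewrite !mxE enum_valK mulrC -!rmorphXn /=.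
by rewrite expf_red.
Qed.

(** A product of one-variable functionals works, since the sum over F_q^n of a product of
    one-variable functions factors. *)
Lemma monomial_functional n (rho : 'I_n -> 'I_q) :
  exists lam : {ffun 'I_n -> Fq} -> k, forall a : 'I_n -> nat,
    \sum_v lam v * \prod_i iota (v i) ^+ a i
      = [forall i, red_exp (a i) == rho i]%:R.
Proof.
have /choice[lam lamE] i := power_functional (rho i).
exists (fun v => \prod_i lam i (v i)) => a.
transitivity (\prod_i \sum_x lam i x * iota x ^+ a i).
  by rewrite bigA_distr_bigA; apply: eq_bigr => v _; rewrite big_split.
under eq_bigr do rewrite lamE.
case: forallP => [H|/forallP]; first by rewrite big1 // => i _; rewrite H.
by rewrite negb_forall => /existsP[i /negPf Hi]; rewrite (bigD1 i) //= Hi mul0r.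
Qed.

Section Gamma.
Variable (m : nat).
Local Notation Gam := (@Gamma k m q).

Lemma Gamma_ideal : is_ideal Gam. Proof. exact: ideal_gen_is_ideal. Qed.

Lemma Gamma_gen (i j : 'I_m.+1) : Gam ('X_i ^+ q * 'X_j - 'X_i * 'X_j ^+ q).
Proof.
have [ij|ji|/val_inj ->] := ltngtP i j.
- by apply: ideal_gen_sub; exists i, j.
- rewrite -opprB; apply: ideal_opp; first exact: Gamma_ideal.
  by apply: ideal_gen_sub; exists j, i; split=> //;
    congr (_ - _); rewrite mulrC.
- by rewrite mulrC subrr; case: Gamma_ideal.
Qed.

Lemma Gamma_eval f (v : 'I_m.+1 -> Fq) : Gam f -> f.@[fun i => iota (v i)] = 0.
Proof.
case=> s [sG ->]; rewrite raddf_sum /= big1_seq // => c.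
case/andP=> _ /sG[i [j [_ ->]]].
rewrite mevalM mevalB !mevalM !rmorphXn /= !mevalXU -!rmorphXn /= !expf_card.
by rewrite subrr mulr0.
Qed.

(** Induction on the total excess of [a] over [b], with truncated subtraction. If they differ, some
    [i] has an excess and some [j] a deficit, each at least [q.-1], so x_i^q x_j divides x^a.
    Replacing it by x_i x_j^q changes x^a by an element of [Gam] and lowers the excess. *)
Lemma Gamma_monomials (a b : 'X_{1..m.+1}) : mdeg a = mdeg b ->
  (forall i, red_exp (a i) = red_exp (b i)) -> Gam ('X_[a] - 'X_[b]).
Proof.
have [G0 GD GM] := Gamma_ideal.
have q1 : (1 < q)%N := finNzRing_gt1 Fq.
have [d] := ubnP (\sum_i (a i - b i))%N.
elim: d a => // d IH a led dab rab.
have [->|nab] := eqVneq a b; first by rewrite subrr.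
have [i lti] := mdeg_eq_lt dab nab.
have [j ltj] : exists j, (a j < b j)%N by apply: mdeg_eq_lt; rewrite // eq_sym.
have [bi_gt0 bi_le] := red_exp_gt (rab i) lti.
have [aj_gt0 aj_le] := red_exp_gt (esym (rab j)) ltj.
have nij : i != j by apply: contraTneq lti => ->; rewrite -leqNgt ltnW.
have nji : j != i by rewrite eq_sym.
pose r : 'X_{1..m.+1} := (a - (U_(i) *+ q + U_(j)))%MM.
have ar : a = (r + (U_(i) *+ q + U_(j)))%MM.
  rewrite submK //; apply/mnm_lepP => l; rewrite mnmDE mulmnE !mnm1E.
  have [<-|_] := eqVneq i l; first by rewrite (negPf nji) mul1n; lia.
  by have [<-|_] := eqVneq j l; rewrite mul0n.
pose c : 'X_{1..m.+1} := (r + (U_(i) + U_(j) *+ q))%MM.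
(* [c] is [a] with [q.-1] units moved from [i] to [j], expressed without subtraction. *)
have cE l : (c l + (i == l) * q.-1 = a l + (j == l) * q.-1)%N.
  rewrite ar /c !mnmDE !mulmnE !mnm1E.
  by case: (i == l); case: (j == l); lia.
rewrite -(subrK 'X_[c] 'X_[a]) -addrA; apply: GD.
  rewrite [X in 'X_[X] - _]ar /c !mpolyXD -mulrBr -!mpolyXn.
  by apply: GM; apply: Gamma_gen.
have ci : (c i + q.-1 = a i)%N by have := cE i; rewrite eqxx (negPf nji); lia.
have cj : (c j = a j + q.-1)%N by have := cE j; rewrite eqxx (negPf nij); lia.
have cl l : l != i -> l != j -> c l = a l.
  move=> li lj; have := cE l.
  by rewrite ![_ == l]eq_sym (negPf li) (negPf lj); lia.
apply: IH.
- move: led; rewrite ltnS; apply: leq_trans.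
  rewrite (bigD1 i) //= [X in (_ < X)%N](bigD1 i) //= -addSn.
  rewrite leq_add //; first by lia.
  apply: leq_sum => l li; have [->|lj] := eqVneq l j; first by lia.
  by rewrite cl.
- rewrite -dab ar /c !mdegD !mdegMn !mdeg1; lia.
- move=> l; rewrite -rab.
  have [->|li] := eqVneq l i; first by rewrite -ci red_expD //; lia.
  have [->|lj] := eqVneq l j; first by rewrite cj red_expD.
  by rewrite cl.
Qed.

(** Group the monomials of [f] by reduced exponents. By [monomial_functional], the coefficients in
    each class sum to 0, so the class is a combination of differences of congruent monomials. *)
Lemma Gamma_vanish e (f : {mpoly k[m.+1]}) : f \is e.-homog ->
  (forall v : 'I_m.+1 -> Fq, f.@[fun i => iota (v i)] = 0) -> Gam f.
Proof.
move=> /dhomogP fe f0; have GI := Gamma_ideal.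
pose rd (a : 'X_{1..m.+1}) : {ffun 'I_m.+1 -> 'I_q} :=
  [ffun i => Ordinal (red_exp_lt (a i))].
have rdP a b : mdeg a = mdeg b -> rd a = rd b -> Gam ('X_[a] - 'X_[b]).
  move=> dab /ffunP rab; apply: Gamma_monomials => // i.
  by have := congr1 val (rab i); rewrite !ffunE.
rewrite [f]mpolyE (partition_big rd predT) //=; apply: ideal_sum => // rho _.
(* Any monomial of the class serves as [b]; the degree bound makes the search finite. An empty class
   contributes nothing. *)
case: (pickP [pred a : 'X_{1..m.+1 < e.+1} |
    (bmnm a \in msupp f) && (rd a == rho)]).
  move=> b /andP[/fe bf /eqP rdb].
  have c0 : \sum_(a <- msupp f | rd a == rho) f@_a = 0.
    have [lam lamE] := monomial_functional rho.
    transitivity (\sum_v lam v * f.@[fun i => iota (v i)]); last first.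
      by rewrite big1 // => v _; rewrite f0 mulr0.
    under [RHS]eq_bigr do rewrite mevalE mulr_sumr.
    rewrite exchange_big big_mkcond /=; apply: eq_bigr => a _.
    under eq_bigr do rewrite mulrCA.
    rewrite -mulr_sumr lamE; case: eqP => [<-|nr].
      rewrite (_ : [forall i, _]) ?mulr1 //.
      by apply/forallP => i; rewrite ffunE.
    case: forallP => [H|]; last by rewrite mulr0.
    case: nr; apply/ffunP => i; rewrite ffunE; apply/val_inj/eqP; exact: H.
  (* Subtracting this zero turns each X^a of the class into X^a - X^b. *)
  have /esym cb0 :
      \sum_(a <- msupp f | rd a == rho) f@_a *: 'X_[b] = 0 :> {mpoly k[m.+1]}.
    by rewrite -scaler_suml c0 scale0r.
  rewrite -[X in Gam X]subr0 [X in _ - X]cb0 -sumrB.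
  rewrite big_seq_cond; apply: ideal_sum => // a /andP[/fe af /eqP rda].
  rewrite -scalerBr -mul_mpolyC; case: GI => _ _; apply.
  by apply: rdP; [rewrite af | rewrite rda].
move=> H; rewrite big_seq_cond big1; first by case: GI.
move=> a /andP[af ra]; have lea : (mdeg a < e.+1)%N by rewrite fe.
by have := H (BMultinom lea); rewrite /= af ra.
Qed.

End Gamma.

End Frobenius.

(** * Evaluation of forms and leading monomials *)

Lemma meval_homogZ n (R : comNzRingType) d (f : {mpoly R[n]}) c
    (v w : 'I_n -> R) :
  f \is d.-homog -> (forall i, w i = c * v i) -> f.@[w] = c ^+ d * f.@[v].
Proof.
move=> /dhomogP fd wE; rewrite !mevalE mulr_sumr big_seq [RHS]big_seq.
apply: eq_bigr => a /fd <-; rewrite mulrCA; congr (_ * _).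
rewrite /= mdegE -prodrXr -big_split /=; apply: eq_bigr => i _.
by rewrite wE exprMn.
Qed.

Lemma dhomog_prod_card n (R : comNzRingType) (T : finType)
    (l : T -> {mpoly R[n]}) :
  (forall t, l t \is 1.-homog) -> \prod_t l t \is #|T|.-homog.
Proof.
move=> l1; rewrite -sum1_card.
apply: (big_rec2 (fun p d => p \is d.-homog)) => [|t p d _ pd].
  exact: dhomog1.
exact: dhomogM.
Qed.

Section LeadingMonomial.
Variables (n : nat) (le : rel 'X_{1..n}) (le_monomial : monomial_order le).

Lemma lm_max (R : nzRingType) (f : {mpoly R[n]}) : f != 0 ->
  lm le f \in msupp f /\ {in msupp f, forall a, le a (lm le f)}.
Proof.
case: le_monomial => anti trans tot _ le0; rewrite -msupp_eq0 /lm.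
elim: (msupp f) => // a s IH _; rewrite big_cons.
have [->|/IH[bs sb]] := eqVneq s [::].
  rewrite big_nil; have -> : (if le a 0%MM then 0%MM else a) = a.
    by case: ifP => // a0; apply: anti; rewrite a0 le0.
  by split=> [|b]; rewrite inE // => /eqP->; have := tot a a; rewrite orbb.
set b := \big[_/_]_(_ <- s) _ in bs sb *.
case: ifPn => ab; split; rewrite ?inE ?eqxx ?bs ?orbT // => c.
  by rewrite inE => /orP[/eqP->|/sb].
have ba : le b a by have := tot a b; rewrite (negPf ab).
rewrite inE => /orP[/eqP->|/sb cb]; last exact: trans cb ba.
by have := tot a a; rewrite orbb.
Qed.

(** Finitely many monomials have degree at most [e], so the number of those below [a] serves as
    induction measure. *)
Lemma mono_ind e (P : 'X_{1..n} -> Prop) :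
  (forall a, mdeg a = e ->
    (forall b, mdeg b = e -> le b a -> b != a -> P b) -> P a) ->
  forall a, mdeg a = e -> P a.
Proof.
case: le_monomial => anti trans tot _ _ IH a.
pose D (a : 'X_{1..n}) := [set b : 'X_{1..n < e.+1} | le b a]%SET.
have [d] := ubnP #|D a|; elim: d a => // d IHd a leD ae.
apply: IH => // b be ba nba; apply: IHd => //.
move: leD; rewrite ltnS; apply: leq_trans; apply: proper_card.
have lea : (mdeg a < e.+1)%N by rewrite ae.
apply/properP; split.
  by apply/fintype.subsetP => c; rewrite !inE => cb; apply: trans cb ba.
exists (BMultinom lea); rewrite !inE /=; first by have := tot a a; rewrite orbb.
by apply: contra_neqN nba => ab; apply: anti; rewrite ba ab.
Qed.

End LeadingMonomial.

(** * Forms of [ideal_q] in large degree *)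

Section RationalPoints.
Variables (Fq : finFieldType) (k : fieldType) (iota : {rmorphism Fq -> k}).
Variables (m : nat) (J : set {mpoly k[m.+1]}).
Hypothesis J_homogeneous : homogeneous_ideal J.
Local Notation q := #|Fq|.
Local Notation ev f v := (f.@[map_mx iota v 0]).
Local Notation V := 'rV[Fq]_m.+1.

(** The affine cone of [J] over F_q: forms have values at vectors, not at points. *)
Definition on_cone (v : V) : Prop :=
  forall f, f \is homog mdeg -> J f -> ev f v = 0.

Lemma ev_homogZ d (f : {mpoly k[m.+1]}) (c : Fq) (v : V) :
  f \is d.-homog -> ev f (c *: v) = iota c ^+ d * ev f v.
Proof.
by move=> fd; apply: meval_homogZ => // i; rewrite !mxE rmorphM.
Qed.

(** The summand in [J] need not be homogeneous, but its homogeneous components lie in [J]; the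
    summand in [Gamma] vanishes because x^q = x on F_q. *)
Lemma ideal_q_eval f v : ideal_q q J f -> on_cone v -> ev f v = 0.
Proof.
case: J_homogeneous => _ Jh [g [h [Jg Gh ->]]] vX; rewrite mevalD.
have -> : ev h v = 0.
  rewrite -[RHS](Gamma_eval iota (v 0) Gh); apply: meval_eq => i.
  by rewrite mxE.
rewrite addr0 (pihomog_partitionE (mf := mdeg) (leqnn _) : g = _) raddf_sum.
rewrite big1 // => d _; apply: vX; last exact: Jh.
by apply: homogE (pihomogP _ _ _).
Qed.

(** For each [w] off the line of [v], some 2x2 minor gives a linear form vanishing at [w] but not at
    [v]. Their product is padded to degree [e] by a coordinate that is nonzero at [v]. *)
Lemma separating_form (v : V) e : v != 0 -> (#|V| <= e)%N ->
  exists h : {mpoly k[m.+1]}, [/\ h \is e.-homog, ev h v != 0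
    & forall w, (forall c, w <> c *: v) -> ev h w = 0].
Proof.
move=> v0 lee.
have [i vi] : exists i, v 0 i != 0.
  apply/existsP; apply: contraNT v0; rewrite negb_exists => /forallP vi.
  by apply/eqP/rowP => i; rewrite mxE; apply/eqP; rewrite -[_ == _]negbK vi.
have Xi : ev ('X_i : {mpoly k[m.+1]}) v != 0 by rewrite mevalXU mxE fmorph_eq0.
have X1 j : ('X_j : {mpoly k[m.+1]}) \is 1.-homog by rewrite dhomogX /= mdeg1.
have /choice[l lP] w : exists l : {mpoly k[m.+1]},
    [/\ l \is 1.-homog, ev l v != 0
    & (forall c, w <> c *: v) -> ev l w = 0].
  have [[c wc]|nc] := pselect (exists c, w = c *: v).
    by exists 'X_i; split=> // /(_ c).
  have [j wj] : exists j, w 0 i * v 0 j != w 0 j * v 0 i.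
    apply/existsP; apply: contra_notT nc; rewrite negb_exists => /forallP wv.
    exists (w 0 i / v 0 i); apply/rowP => j; rewrite !mxE.
    have /negPn/eqP wvj := wv j.
    by apply: (mulIf vi); rewrite mulrAC divfK.
  exists (iota (w 0 i) *: 'X_j - iota (w 0 j) *: 'X_i); split.
  - by rewrite rpredB // rpredZ.
  - rewrite mevalB !mevalZ !mevalXU !mxE -!rmorphM subr_eq0.
    by apply: contra_neq wj => /fmorph_inj.
  - by rewrite mevalB !mevalZ !mevalXU !mxE mulrC subrr.
exists (\prod_w l w * 'X_i ^+ (e - #|V|)); split.
- rewrite -(subnKC lee); apply: dhomogM.
    by apply: dhomog_prod_card => w; case: (lP w).
  by rewrite -[X in X.-homog](mul1n) subnKC //; apply: dhomogMn.
- rewrite mevalM rmorphXn rmorph_prod mulf_neq0 ?expf_neq0 //.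
  by apply/prodf_neq0 => w _; case: (lP w).
- move=> w nw; rewrite mevalM rmorph_prod (bigD1 w) //=.
  by case: (lP w) => _ _ ->; rewrite ?mul0r.
Qed.

(** Induction on the number of vectors where [f] is nonzero. At such a [v], some form of [J] is
    nonzero; a multiple of it by a separating form cancels the value of [f] there. Once no such
    vector is left, [Gamma_vanish] applies. *)
Lemma vanishing_in_ideal_q : exists e0, forall e f, (e0 <= e)%N ->
  f \is e.-homog -> (forall v, v != 0 -> on_cone v -> ev f v = 0) ->
  ideal_q q J f.
Proof.
case: J_homogeneous => [[J0 JD JM] _].
have /choice[g gP] v : exists g : nat * {mpoly k[m.+1]}, ~ on_cone v ->
    [/\ g.2 \is (g.1).-homog, J g.2 & ev g.2 v != 0].
  have [vX|nvX] := pselect (on_cone v); first by exists (0, 0).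
  have /existsNP[f /not_implyP[/homogP[d fd] /not_implyP[Jf fv]]] := nvX.
  by exists (d, f) => _; split=> //; apply/eqP.
(* After removing the degree of any [(g v).2], at least [#|V|] remains for the separating form. *)
exists (#|V| + \sum_v (g v).1)%N => e f lee fe fX.
have [d] := ubnP #|[set v : V | ev f v != 0]%SET|.
elim: d f fe fX => // d IH f fe fX led.
have [/forallP f0|] := boolP [forall v : V, ev f v == 0].
  exists 0, f; split; rewrite ?add0r //.
  apply: (Gamma_vanish (iota := iota) fe) => v.
  rewrite -[RHS](eqP (f0 (\row_i v i))); apply: meval_eq => i.
  by rewrite !mxE.
rewrite negb_forall => /existsP[v fv].
have V0 : (0 < #|V|)%N by apply/card_gt0P; exists 0.
(* The bound on [e] makes it positive, so [f] vanishes at the zero vector. *)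
have v0 : v != 0.
  apply: contra_neq fv => ->; rewrite -(scale0r 0) (ev_homogZ _ _ fe).
  rewrite rmorph0 expr0n; case: e lee {fe IH} => [|e].
    lia.
  by rewrite mul0r.
have nvX : ~ on_cone v by move=> /(fX _ v0) /eqP; apply/negP.
have [gd Jg gv] := gP v nvX.
have legv : ((g v).1 <= \sum_v (g v).1)%N by rewrite (bigD1 v) //= leq_addr.
have [|h [hd hv hw]] := @separating_form v (e - (g v).1) v0; first lia.
pose c := ev f v / (ev (g v).2 v * ev h v).
pose f' := f - c *: (h * (g v).2).
have hg : h * (g v).2 \is e.-homog.
  rewrite -[X in X.-homog](@subnK (g v).1 e); last lia.
  exact: dhomogM.
have fd' : f' \is e.-homog by rewrite rpredB // rpredZ.
have Jh : J (c *: (h * (g v).2)) by rewrite -mul_mpolyC; apply/JM/JM.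
have f'v : ev f' v = 0.
  rewrite mevalB mevalZ mevalM [_ * ev _.2 _]mulrC divfK ?subrr //.
  by rewrite mulf_neq0.
(* Off the line of [v] the correction is zero; on it, homogeneity spreads the zero at [v]. *)
have f'w (w : V) : ev f w = 0 -> ev f' w = 0.
  move=> fw; have [[b ->]|nb] := pselect (exists b, w = b *: v).
    by rewrite (ev_homogZ _ _ fd') f'v mulr0.
  rewrite mevalB mevalZ mevalM hw ?mul0r ?mulr0 ?subr0 // => b wb.
  by apply: nb; exists b.
have [//|w w0 /fX fw||a [b [Ja Gb f'E]]] := IH f'.
- by apply: f'w; apply: fw.
- move: led; rewrite ltnS; apply: leq_trans; apply: proper_card.
  apply/properP; split.
    apply/fintype.subsetP => w; rewrite !inE; apply: contra_neq; exact: f'w.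
  by exists v; rewrite !inE ?f'v ?eqxx.
- exists (a + c *: (h * (g v).2)), b; split=> //; first exact: JD.
  by rewrite addrAC -f'E /f' subrK.
Qed.

End RationalPoints.

(** * Footprints and evaluation at finitely many points *)

Lemma meval_msupp n (R : comNzRingType) (f : {mpoly R[n]}) v :
  f.@[v] = \sum_(a <- msupp f) f@_a * ('X_[a] : {mpoly R[n]}).@[v].
Proof. by rewrite mevalE; apply: eq_bigr => a _; rewrite mevalX. Qed.

Lemma row_freeW (F : fieldType) m n (A : 'M[F]_(m, n)) :
  (forall u : 'rV_m, u *m A = 0 -> u = 0) -> row_free A.
Proof.
by move=> A0; rewrite -kermx_eq0; apply/rowV0P => u /sub_kermxP; exact: A0.
Qed.

Lemma card_eq_finset (T U : finType) (A : {set T}) (B : {set U}) :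
  #|A| = #|B| -> [set` A] #= [set` B].
Proof.
have H (W : finType) (C : {set W}) : [set` C] #= [set: 'I_#|C|].
  have -> : [set` C] = [set enum_val i | i in [set: 'I_#|C|]].
    apply/seteqP; split=> [x xC|_ [i _ <-]]; last exact: enum_valP.
    by exists (enum_rank_in xC x); rewrite ?enum_rankK_in.
  by apply: inj_card_eq => i j _ _; apply: enum_val_inj.
by move=> AB; apply: card_eq_trans (H _ A) _; rewrite AB card_eq_sym.
Qed.

Section Duality.
Variables (k : fieldType) (n e : nat) (le : rel 'X_{1..n}).
Hypothesis le_monomial : monomial_order le.
Variables (T : finType) (pt : T -> 'I_n -> k) (I : set {mpoly k[n]}).
Hypothesis I_vanishing : forall f : {mpoly k[n]}, f \is e.-homog ->
  I f <-> forall t, f.@[pt t] = 0.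
Hypothesis separated : forall t, exists f : {mpoly k[n]},
  [/\ f \is e.-homog, f.@[pt t] != 0 & forall s, s != t -> f.@[pt s] = 0].

(* The evaluation matrix of the footprint monomials at the points is square and
   invertible: a row relation is an element of I supported on the footprint, and
   a column relation is a functional on forms of degree e that kills the
   footprint, hence, by induction on the order, all monomials. *)
Lemma footprint_card : footprint le I e #= [set: T].
Proof.
pose B : {set 'X_{1..n < e.+1}} :=
  [set b | `[< footprint le I e (bmnm b) >]]%SET.
have BP (a : 'X_{1..n}) : footprint le I e a -> exists2 b, b \in B & bmnm b = a.
  move=> aB; have lea : (mdeg a < e.+1)%N by case: (aB) => ->.
  by exists (BMultinom lea); rewrite // inE; apply/asboolP.
have -> : footprint le I e = [set bmnm b | b in [set` B]].
  apply/seteqP; split=> [a /BP[b bB <-]|_ [b /= bB <-]]; first by exists b.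
  by move: bB; rewrite inE => /asboolP.
apply: card_eq_trans (inj_card_eq _) _; first by move=> b c _ _ /val_inj.
rewrite -(_ : [set` [set: T]%SET] = [set: T]); last first.
  by apply/seteqP; split=> t //= _; rewrite inE.
apply: card_eq_finset; rewrite cardsT.
pose mon (i : 'I_#|B|) : 'X_{1..n} := bmnm (enum_val i).
have monB i : footprint le I e (mon i).
  by have := enum_valP i; rewrite inE => /asboolP.
have mon_inj : injective mon by move=> i j /val_inj /enum_val_inj.
pose M : 'M[k]_(#|B|, #|T|) :=
  \matrix_(i, j) ('X_[mon i] : {mpoly k[n]}).@[pt (enum_val j)].
have /eqP <- : row_free M.
  apply: row_freeW => u uM.
  pose f : {mpoly k[n]} := \sum_i u 0 i *: 'X_[mon i].
  have fc i : f@_(mon i) = u 0 i.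
    rewrite raddf_sum (bigD1 i) //= mcoeffZ mcoeffX eqxx mulr1 big1 ?addr0 //.
    by move=> j ji; rewrite mcoeffZ mcoeffX (inj_eq mon_inj) (negPf ji) mulr0.
  have fe : f \is e.-homog.
    apply: rpred_sum => i _; apply: rpredZ; rewrite dhomogX /=.
    by case: (monB i) => ->.
  have If : I f.
    apply/I_vanishing => // t.
    have := congr1 (fun A : 'rV_#|T| => A 0 (enum_rank t)) uM.
    rewrite !mxE => <-; rewrite raddf_sum; apply: eq_bigr => i _.
    by rewrite mxE /= mevalZ enum_rankK.
  have [f0|f0] := eqVneq f 0.
    by apply/rowP => i; rewrite -fc f0 mcoeff0 mxE.
  have [lmf _] := lm_max le_monomial f0.
  have [i /eqP lmi] : exists i, mon i == lm le f.
    apply/existsP; apply: contraLR lmf; rewrite negb_exists => /forallP nmon.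
    rewrite -mcoeff_eq0 raddf_sum big1 // => i _.
    by rewrite /= mcoeffZ mcoeffX (negPf (nmon i)) mulr0.
  by case: (monB i) => _ /(_ f (homogE fe) If f0).
rewrite -mxrank_tr; apply/eqP/row_freeW => c cM.
have mon0 a : mdeg a = e ->
    \sum_j c 0 j * ('X_[a] : {mpoly k[n]}).@[pt (enum_val j)] = 0.
  move: a; apply: (mono_ind le_monomial) => a ae IH.
  have [/BP[b bB <-]|] := pselect (footprint le I e a).
    have := congr1 (fun A : 'rV_#|B| => A 0 (enum_rank_in bB b)) cM.
    rewrite !mxE => {2}<-; apply: eq_bigr => j _.
    by rewrite !mxE /mon enum_rankK_in.
  (* The functional kills [f] and, by induction, its smaller monomials; hence it kills the leading
     one, [a]. *)
  move=> naB; have [f [fh If f0 af]] :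
      exists f, [/\ f \is homog mdeg, I f, f != 0 & a = lm le f].
    apply: contra_notP naB => nf; split=> // f fh If f0 af; apply: nf.
    by exists f.
  have [lmf lef] := lm_max le_monomial f0; rewrite -af in lmf lef.
  have fe : f \is e.-homog.
    by have/homogP[d fd] := fh; rewrite -ae (dhomog_mf fd lmf).
  have fpt := (I_vanishing fe).1 If.
  have : \sum_j c 0 j * f.@[pt (enum_val j)] = 0.
    by rewrite big1 // => j _; rewrite fpt mulr0.
  under eq_bigr do rewrite meval_msupp mulr_sumr.
  rewrite exchange_big (bigD1_seq a) ?msupp_uniq //=.
  rewrite [X in _ + X]big_seq_cond [X in _ + X]big1 => [|b /andP[bf ba]].
    under eq_bigr do rewrite mulrCA.
    rewrite addr0 -mulr_sumr => /eqP; rewrite mulf_eq0 mcoeff_eq0 lmf /=.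
    by move/eqP.
  under eq_bigr do rewrite mulrCA.
  by rewrite -mulr_sumr IH ?mulr0 //; [exact: (dhomog_mf fe) | exact: lef].
have c0 f : f \is e.-homog -> \sum_j c 0 j * f.@[pt (enum_val j)] = 0.
  move=> /dhomogP fe; under eq_bigr do rewrite meval_msupp mulr_sumr.
  rewrite exchange_big big_seq big1 //= => a /fe ae.
  under eq_bigr do rewrite mulrCA.
  by rewrite -mulr_sumr mon0 ?mulr0.
(* A form nonzero at a single point isolates the entry of [c] there. *)
apply/rowP => j; have [f [fe fj fs]] := separated (enum_val j).
move: (c0 f fe); rewrite (bigD1 j) //= big1 ?addr0 => [|i ij].
  by move/eqP; rewrite mulf_eq0 (negPf fj) orbF mxE => /eqP.
by rewrite fs ?mulr0 // (inj_eq enum_val_inj).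
Qed.

End Duality.

(** * Counting rational points through chosen coordinate vectors *)

Lemma vlineZ (K : fieldType) (V : vectType K) c (v : V) : c != 0 ->
  <[c *: v]>%VS = <[v]>%VS.
Proof.
move=> c0; apply/eqP; rewrite eqEsubv -!memvE; apply/andP; split.
  by apply/vlineP; exists c.
by apply/vlineP; exists c^-1; rewrite scalerA mulVf ?scale1r.
Qed.

Theorem theorem3p7 (q : nat) (Fq : finFieldType) (card_Fq : #|Fq| = q)
  (k : closedFieldType) (iota : {rmorphism Fq -> k})
  (k_algebraic : forall z : k, algebraicOver iota z)
  (m : nat) (m_gt0 : (0 < m)%N)
  (le : rel 'X_{1..m.+1})
  (le_monomial : monomial_order le) (le_vars : vars_decreasing le)
  (J : set {mpoly k[m.+1]}) (J_homogeneous : homogeneous_ideal J) :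
  exists e0 : nat, forall e : nat, (e0 <= e)%N ->
    rational_points iota (zero_locus J) #= footprint le (ideal_q q J) e.
Proof.
rewrite -{}card_Fq.
have [e1 e1P] := vanishing_in_ideal_q iota J_homogeneous.
(* [e1] puts forms vanishing on the cone into [ideal_q]; the other summand provides separating
   forms. *)
exists (e1 + #|'rV[Fq]_m.+1|)%N => e lee.
set X := rational_points _ _.
have /choice[g gP] P : exists v : 'rV[Fq]_m.+1,
    X P -> is_coord (map_mx iota v) P.
  have [[_ [v vP]]|nXP] := pselect (X P); first by exists v.
  by exists 0 => /nXP.
(* One coordinate vector per rational point: as a subtype of a finite type, [T] is finite. *)
pose T := {v : 'rV[Fq]_m.+1 | `[< (g @` X) v >]}.
have g_inj : {in X &, injective g}.
  move=> P Q /set_mem/gP vP /set_mem/gP vQ PQ; apply: val_inj.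
  by rewrite vP vQ PQ.
have XT : X #= [set: T].
  apply: card_eq_trans (card_esym (inj_card_eq g_inj)) _.
  have -> : g @` X = [set val t | t in [set: T]].
    apply/seteqP; split=> [v gv|_ [[v /asboolP gv] _ <-]] //.
    by exists (exist _ v (asboolT gv)).
  by apply: inj_card_eq => s t _ _; apply: val_inj.
have TP (t : T) : exists2 P, X P & g P = val t.
  by have /asboolP[P] := valP t; exists P.
have T0 (t : T) : val t != 0.
  have [P XP <-] := TP t; apply: contra_eq_neq (valP P) => g0.
  by rewrite (gP P XP) g0 map_mx0 dim_vline eqxx.
have T_cone (t : T) : on_cone iota J (val t).
  by have [P XP <-] := TP t => f fh Jf; apply: (XP.1 f fh Jf); apply: gP.
(* The scalar [c] lies in [k], which suffices to transfer the vanishing of a form. *)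
have T_repr (v : 'rV[Fq]_m.+1) : v != 0 -> on_cone iota J v ->
    exists (t : T) c, map_mx iota v = c *: map_mx iota (val t).
  move=> v0 vX; have dv : \dim <[map_mx iota v]> == 1%N.
    by rewrite dim_vline map_mx_eq0 v0.
  pose P : proj_space k m := exist _ <[map_mx iota v]>%VS dv.
  have XP : X P.
    split; last by exists v.
    move=> f fh Jf w Pw.
    have /vlineP[c ->] : w \in <[map_mx iota v]>%VS.
      by rewrite [<[_]>%VS]Pw memv_line.
    have /homogP[d fd] := fh.
    rewrite (@meval_homogZ _ _ d f c (map_mx iota v 0)) ?vX ?mulr0 // => i.
    by rewrite mxE.
  have gX : (g @` X) (g P) by exists P.
  exists (exist _ (g P) (asboolT gX)).
  by apply/vlineP; rewrite -(gP P XP) memv_line.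
apply: card_eq_trans XT _; rewrite card_eq_sym.
apply: (footprint_card le_monomial (pt := fun t : T => map_mx iota (val t) 0)).
- move=> f fe; split=> [If t|fT]; first by apply: ideal_q_eval If (T_cone t).
  apply: (e1P e f) => //; first exact: leq_trans (leq_addr _ _) lee.
  move=> v v0 /(T_repr v v0)[t [c vc]].
  rewrite vc (meval_homogZ (c := c) (v := map_mx iota (val t) 0) fe).
    by rewrite fT mulr0.
  by move=> i; rewrite mxE.
- move=> t.
  have [|h [he ht hs]] := @separating_form Fq k iota m (val t) e (T0 t).
    exact: leq_trans (leq_addl _ _) lee.
  (* Proportional representatives span the same line, so they were chosen for the same point. *)
  exists h; split=> // s nst; apply: hs => c sc; case/eqP: nst; apply: val_inj.
  have [P XP Pt] := TP t; have [Q XQ Qs] := TP s.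
  suff PQ : P = Q by rewrite -Pt -Qs PQ.
  apply: val_inj; rewrite (gP P XP) (gP Q XQ) Pt Qs sc map_mxZ.
  rewrite vlineZ // fmorph_eq0; apply: contra_neq (T0 s) => c0.
  by rewrite sc c0 scale0r.
Qed.
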